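(* Let $n,m\ge1$, $\mathcal X\subseteq\mathbb Z^p\times\mathbb R^{n-p}$ with $0\le p\le n$, and for every $i\in[m]$ let $\mathcal U_i\subseteq\mathbb R^{L_i}$ be a set, $\overline u^i\in\mathcal U_i$, and $f_i:\mathbb R^n\times\mathcal U_i\to\mathbb R$ an arbitrary function. Let $\Gamma\in[m]$. Then the $\Gamma$-counterpart $$\inf_{x\in\mathcal X}\ \sup_{\mathcal S\subseteq[m]:|\mathcal S|\le\Gamma}\Big\{\sum_{i\in\mathcal S}\sup_{u^i\in\mathcal U_i}f_i(x,u^i)+\sum_{i\in[m]\setminus\mathcal S}f_i(x,\overline u^i)\Big\}$$ is equivalent to $$\begin{aligned}\inf_{x,p,\theta}\ &\Gamma\theta+\sum_{i\in[m]}\big(f_i(x,\overline u^i)+p_i\big)\\ \text{s.t. }&x\in\mathcal X,\\ &p_i+\theta\ \ge\ \sup_{u^i\in\mathcal U_i}f_i(x,u^i)-f_i(x,\overline u^i)\quad\forall i\in[m],\\ &p\in\mathbb R^m_{\ge0},\ \theta\in\mathbb R_{\ge0}.\end{aligned}$$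
   Context: Notation: $[m]:=\{1,\dots,m\}$. A constraint whose right-hand side equals $+\infty$ is violated. Two minimization programs in $x$ (possibly with further auxiliary variables or indices) are called equivalent if they have the same optimal value in $[-\infty,\infty]$ and, whenever this value is finite, a point $x\in\mathcal X$ attains it in one program (for a suitable choice of the auxiliary variables or indices) if and only if it does so in the other. *)

(* Defs.v *)
From mathcomp Require Import all_boot all_order all_algebra.
From mathcomp Require Import boolp classical_sets reals ereal.

Set Implicit Arguments.
Unset Strict Implicit.
Unset Printing Implicit Defensive.

Import Order.TTheory GRing.Theory Num.Theory.

Local Open Scope classical_set_scope.
Local Open Scope ring_scope.

(* [A] is the type of the auxiliary variables ([unit] if there are none). *)
Record program (R : realType) (T A : Type) := Program {
  feasible : T -> A -> Prop ;
  objective : T -> A -> \bar R }.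

Definition optval (R : realType) (T A : Type) (P : program R T A) : \bar R :=
  ereal_inf [set objective P z.1 z.2 | z in [set z | feasible P z.1 z.2]].

Definition attains (R : realType) (T A : Type) (P : program R T A) (x : T) :=
  exists2 a : A, feasible P x a & objective P x a = optval P.

Definition equivalent_on (R : realType) (T A B : Type) (X : set T)
    (P : program R T A) (Q : program R T B) :=
  optval P = optval Q /\
  (optval P \is a fin_num -> forall x, X x -> (attains P x <-> attains Q x)).

(* Z^q x R^(n-q) *)
Definition mixed_integer (R : realType) (n q : nat) : set 'rV[R]_n :=
  [set x : 'rV[R]_n | forall j : 'I_n, (j < q)%N -> x ord0 j \is a Num.int].

Section GammaRobust.
Variables (R : realType) (n m : nat) (X : set 'rV[R]_n).
Variables (L : 'I_m -> nat) (U : forall i : 'I_m, set 'rV[R]_(L i)).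
Arguments U : clear implicits.
Variables (ubar : forall i : 'I_m, U i).
Variables (f : forall i : 'I_m, 'rV[R]_n -> U i -> R).
Arguments f : clear implicits.
Variable Gamma : nat.

Definition worst_case (i : 'I_m) (x : 'rV[R]_n) : \bar R :=
  ereal_sup [set (f i x u)%:E | u in [set: U i]].

Definition gamma_counterpart : program R 'rV[R]_n unit := {|
  feasible x _ := X x ;
  objective x _ :=
    ereal_sup [set (\sum_(i in S) worst_case i x
                    + \sum_(i in ~: S) (f i x (ubar i))%:E)%E
              | S in [set S : {set 'I_m} | (#|S| <= Gamma)%N]] |}.

(* The auxiliary variables are the pairs [(p, theta)].  The right-hand side of
   the coupling constraint may be [+oo], in which case it is violated. *)
Definition gamma_reformulation : program R 'rV[R]_n ('rV[R]_m * R) := {|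
  feasible x (a : 'rV[R]_m * R) :=
    [/\ X x,
        forall i, (worst_case i x - (f i x (ubar i))%:E
                   <= (a.1 ord0 i + a.2)%:E)%E,
        forall i, 0 <= a.1 ord0 i
      & 0 <= a.2] ;
  objective x (a : 'rV[R]_m * R) :=
    (Gamma%:R * a.2 + \sum_i (f i x (ubar i) + a.1 ord0 i))%:E |}.

End GammaRobust.

(* Main.v *)
Require Import Defs.
From mathcomp Require Import all_boot all_order all_algebra.
From mathcomp Require Import boolp classical_sets reals ereal.

Import Order.TTheory GRing.Theory Num.Theory.

Local Open Scope classical_set_scope.
Local Open Scope ring_scope.

(** Fix [x] in [X], and let [d i] be the worst-case deviation of the [i]-th term
    from its nominal value; it is nonnegative because the nominal scenario is
    one of the scenarios.  For a fixed [x] the adversary gains the sum of the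
    [Gamma] largest deviations, and this sum is the value of a linear program
    whose dual is the minimization of [Gamma * theta + \sum_i p i] subject to
    [p i + theta >= d i] and nonnegativity.  Weak duality is a pointwise
    estimate, valid even before the deviations are known to be finite
    ([counterpart_le_reformulation]).  For strong duality no linear programming
    is needed: taking [theta] to be the [Gamma]-th largest deviation and
    [p i] the excess of [d i] over [theta] closes the gap
    ([excess_threshold], [reformulation_attains_counterpart]).

    Infinite deviations match on both sides: since [Gamma >= 1], an infinite
    deviation can be selected by the adversary, which makes the counterpart
    [+oo] at [x], while the reformulation has no feasible [(p, theta)] there.

    So, at every [x], the best choice of [(p, theta)] exists and has the value
    of the counterpart whenever that value is not [+oo].  Partial minimization
    over auxiliary variables with attained minimum preserves both the optimal
    value and the optimal points ([equivalent_partial_min]). *)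

(** The condition [objective P x tt < +oo] in the second hypothesis allows
    points at which [Q] is infeasible; such points change neither infimum, and
    cannot be optimal when the optimal value is finite. *)
Lemma equivalent_partial_min (R : realType) (T B : Type) (X : set T)
    (P : program R T unit) (Q : program R T B) :
    (forall x b, feasible Q x b ->
       feasible P x tt /\ (objective P x tt <= objective Q x b)%E) ->
    (forall x, feasible P x tt -> (objective P x tt < +oo)%E ->
       exists2 b, feasible Q x b & (objective Q x b <= objective P x tt)%E) ->
  equivalent_on X P Q.
Proof.
move=> lower reach.
have optP x : feasible P x tt -> (optval P <= objective P x tt)%E.
  by move=> Px; apply: ereal_inf_lbound; exists (x, tt).
have optQ x b : feasible Q x b -> (optval Q <= objective Q x b)%E.
  by move=> Qxb; apply: ereal_inf_lbound; exists (x, b).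
have eqPQ : optval P = optval Q.
  apply/eqP; rewrite eq_le; apply/andP; split.
    apply: le_ereal_inf_tmp => _ [[x b] /= Qxb <-].
    have [Px le_PQ] := lower _ _ Qxb.
    exact: le_trans (optP _ Px) le_PQ.
  apply: le_ereal_inf_tmp => _ [[x []] /= Px <-].
  have [Pfin|] := boolP (objective P x tt < +oo)%E; last first.
    by rewrite -leNgt leye_eq => /eqP ->; rewrite leey.
  have [b Qxb le_QP] := reach x Px Pfin.
  exact: le_trans (optQ _ _ Qxb) le_QP.
split=> // fin_opt x _; split.
- move=> [[] Px Pval].
  have [|b Qxb le_QP] := reach x Px; first by rewrite Pval ltey_eq fin_opt.
  exists b => //; apply/eqP; rewrite eq_le optQ // andbT.
  by rewrite -eqPQ -Pval.
- move=> [b Qxb Qval]; have [Px le_PQ] := lower _ _ Qxb.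
  exists tt => //; apply/eqP; rewrite eq_le optP // andbT.
  by rewrite eqPQ -Qval.
Qed.

(** A subset of given size with the largest possible sum consists of largest
    elements, since otherwise exchanging its least element for a larger one
    outside would increase the sum. *)
Lemma largest_subset (K : realDomainType) (T : finType) (d : T -> K) (k : nat) :
    (0 < k <= #|T|)%N ->
  exists (S : {set T}) (i0 : T),
    [/\ #|S| = k, i0 \in S, forall i, i \in S -> d i0 <= d i
      & forall i, i \notin S -> d i <= d i0].
Proof.
move=> /andP[k_gt0 k_le].
have [S0 cardS0] : exists S0 : {set T}, #|S0| == k.
  have : (0 < #|[set S : {set T} | #|S| == k]%SET|)%N.
    by rewrite card_draws bin_gt0.
  by case/card_gt0P=> S0; rewrite inE; exists S0.
have := @Order.TotalTheory.arg_maxP _ K _ S0 (fun S : {set T} => #|S| == k)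
  (fun S : {set T} => \sum_(i in S) d i) cardS0.
case=> S /eqP cardS maxS.
have [i1 Si1] : exists i, i \in S by apply/card_gt0P; rewrite cardS.
have := @Order.TotalTheory.arg_minP _ K _ i1 [in S] d Si1.
case=> i0 Si0 min_i0.
exists S, i0; split=> // j Sj.
have Sj' : j \notin S :\ i0 by rewrite !inE negb_and Sj orbT.
have := maxS (j |: (S :\ i0)).
rewrite cardsU1 Sj' -cardS (cardsD1 i0 S) Si0 => /(_ (eqxx _)).
by rewrite big_setU1 //= (big_setD1 i0 Si0) /= lerD2r.
Qed.

(** Strong duality: [t] is the [k]-th largest element, so the elements with a
    positive excess over [t] all lie in the [k]-element set [S], and
    [t *+ k] restores what was subtracted from each of them. *)
Lemma excess_threshold (K : realDomainType) (T : finType) (d : T -> K)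
    (k : nat) :
    (0 < k <= #|T|)%N -> (forall i, 0 <= d i) ->
  exists (S : {set T}) (t : K),
    [/\ #|S| = k, 0 <= t
      & k%:R * t + \sum_i Num.max (d i - t) 0 = \sum_(i in S) d i].
Proof.
move=> k_range d_ge0.
have [S [i0 [cardS _ minS maxS]]] := largest_subset _ _ d _ k_range.
exists S, (d i0); split=> //.
rewrite (bigID [in S]) /= [X in _ + (_ + X)]big1 ?addr0; last first.
  by move=> i /maxS di; apply/max_idPr; rewrite subr_le0.
rewrite (eq_bigr (fun i => d i - d i0)); last first.
  by move=> i /minS di; apply/max_idPl; rewrite subr_ge0.
by rewrite sumrB sumr_const cardS mulr_natl addrC subrK.
Qed.

Lemma sum_shift_on_set (K : zmodType) (T : finType) (S : {set T})
    (a d : T -> K) :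
  \sum_(i in S) (a i + d i) + \sum_(i in ~: S) a i
    = \sum_i a i + \sum_(i in S) d i.
Proof.
rewrite big_split /= addrAC; congr (_ + _).
rewrite [RHS](bigID [in S]) /=; congr (_ + _).
by apply: eq_bigl => i; rewrite inE.
Qed.

Section FixedDecision.
Variables (R : realType) (n m : nat) (X : set 'rV[R]_n).
Variables (L : 'I_m -> nat) (U : forall i : 'I_m, set 'rV[R]_(L i)).
Variables (ubar : forall i : 'I_m, U i).
Variables (f : forall i : 'I_m, 'rV[R]_n -> U i -> R).
Variable Gamma : nat.

Let fbar i x : R := f i x (ubar i).
Let w i x : \bar R := worst_case f i x.
Let P := gamma_counterpart X ubar f Gamma.
Let Q := gamma_reformulation X ubar f Gamma.

Lemma nominal_le_worst_case i x : ((fbar i x)%:E <= w i x)%E.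
Proof. by apply: ereal_sup_ubound; exists (ubar i). Qed.

(** Weak duality: each of the at most [Gamma] selected deviations is bounded by
    [p i + theta]; the unselected [p i] are dropped because they are
    nonnegative. *)
Lemma counterpart_le_reformulation x a :
  feasible Q x a -> (objective P x tt <= objective Q x a)%E.
Proof.
case: a => p t [_ cover p_ge0 t_ge0].
apply: ge_ereal_sup => _ [S /= cardS <-].
have w_le i : (w i x <= (fbar i x + (p ord0 i + t))%:E)%E.
  by have := cover i; rewrite leeBlDr // -EFinD [in leRHS]addrC.
apply: (@le_trans _ _
  (\sum_(i in S) (fbar i x + (p ord0 i + t))%:E
   + \sum_(i in ~: S) (fbar i x)%:E)%E).
  by apply: leeD => //; apply: lee_sum => i _; apply: w_le.
rewrite !sumEFin -EFinD lee_fin sum_shift_on_set.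
rewrite !big_split /= [leRHS]addrCA lerD2l addrC sumr_const lerD //.
  by rewrite mulr_natl ler_wpMn2l.
by rewrite [leRHS](bigID [in S]) /= lerDl sumr_ge0.
Qed.

(** The adversary may select the single index [i] since [Gamma >= 1], so an
    infinite worst case of [i] would make the counterpart infinite. *)
Lemma worst_case_lty x : (0 < Gamma)%N ->
  (objective P x tt < +oo)%E -> forall i, (w i x < +oo)%E.
Proof.
move=> Gamma_gt0 Pfin i.
have : ((w i x + \sum_(j in ~: [set i]%SET) (fbar j x)%:E) <= objective P x tt)%E.
  apply: ereal_sup_ubound; exists [set i]%SET; rewrite /= ?cards1 //.
  by rewrite big_set1.
move=> /le_lt_trans /(_ Pfin); rewrite sumEFin.
by case: (w i x) => [r||] //; rewrite ?ltry ?ltNyr ?addye //.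
Qed.

Lemma reformulation_attains_counterpart x : (0 < Gamma <= m)%N -> X x ->
    (objective P x tt < +oo)%E ->
  exists2 a, feasible Q x a & (objective Q x a <= objective P x tt)%E.
Proof.
move=> Gamma_range Xx Pfin.
have /andP[Gamma_gt0 _] := Gamma_range.
pose d i : R := fine (w i x) - fbar i x.
have wE i : w i x = (fbar i x + d i)%:E.
  rewrite /d addrC subrK fineK //.
  rewrite fin_numE (lt_eqF (worst_case_lty _ Gamma_gt0 Pfin i)) andbT.
  rewrite -ltNye.
  exact: lt_le_trans (ltNyr _) (nominal_le_worst_case i x).
have d_ge0 i : 0 <= d i.
  by have := nominal_le_worst_case i x; rewrite wE lee_fin lerDl.
have [|S [t [cardS t_ge0 sumE]]] := excess_threshold _ _ d Gamma _ d_ge0.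
  by rewrite card_ord.
exists (\row_i Num.max (d i - t) 0, t).
- split=> //= i.
  + rewrite -/(w i x) wE -EFinB lee_fin mxE addrAC subrr add0r.
    by rewrite -lerBlDr le_max lexx.
  + by rewrite mxE le_max lexx orbT.
- apply: ereal_sup_ubound; exists S; rewrite /= ?cardS //.
  rewrite (eq_bigr _ (fun i _ => wE i)) !sumEFin -EFinD sum_shift_on_set.
  rewrite -sumE big_split /= addrCA; congr (_ + (_ + _))%:E.
  by apply: eq_bigr => i _; rewrite mxE.
Qed.

End FixedDecision.

Theorem lemma3p1 (R : realType) (n m q : nat)
    (n_ge1 : (1 <= n)%N) (m_ge1 : (1 <= m)%N) (q_le_n : (q <= n)%N)
    (X : set 'rV[R]_n) (X_mixed : X `<=` @mixed_integer R n q)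
    (L : 'I_m -> nat) (U : forall i : 'I_m, set 'rV[R]_(L i))
    (ubar : forall i : 'I_m, U i)
    (f : forall i : 'I_m, 'rV[R]_n -> U i -> R)
    (Gamma : nat) (Gamma_in : (1 <= Gamma <= m)%N) :
  equivalent_on X
    (gamma_counterpart X ubar f Gamma)
    (gamma_reformulation X ubar f Gamma).
Proof.
apply: equivalent_partial_min => [x a Qxa | x Xx].
- split; first by case: Qxa.
  exact: counterpart_le_reformulation.
- exact: reformulation_attains_counterpart.
Qed.
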